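(* Let $(X,\mathcal{A})$ be a measurable space, let $\mu\colon\mathcal{A}\to[0,\infty]$ be a nonadditive measure, and let $0<p<\infty$ and $0<q<\infty$. Assume that $\mu$ is conditionally order continuous. Then $\mathcal{S}(X)\cap\mathcal{L}^{p,q}(\mu)$ is dense in $\mathcal{L}^{p,q}(\mu)$. If $\mu$ is additionally assumed to be null-additive, then $S(X)\cap L^{p,q}(\mu)$ is dense in $L^{p,q}(\mu)$.
   Context: $X$ is a nonempty set and $\mathcal{A}$ is a $\sigma$-field of subsets of $X$. A nonadditive measure is a set function $\mu\colon\mathcal{A}\to[0,\infty]$ with $\mu(\emptyset)=0$ and $\mu(A)\le\mu(B)$ whenever $A,B\in\mathcal{A}$, $A\subset B$. $\mathcal{F}_0(X)$ is the real linear space of all $\mathcal{A}$-measurable functions $X\to\mathbb{R}$; $\mathcal{S}(X)$ is the set of all $\mathcal{A}$-measurable simple functions (real-valued, taking finitely many values). Conditionally order continuous: $\mu(A_n)\to 0$ whenever $\{A_n\}_{n\in\mathbb{N}}\subset\mathcal{A}$ is nonincreasing with $\bigcap_{n=1}^\infty A_n=\emptyset$ and $\mu(A_1)<\infty$. Null-additive: $\mu(A\cup B)=\mu(A)$ whenever $A,B\in\mathcal{A}$ and $\mu(B)=0$. Choquet integral: $\mathrm{Ch}(\nu,g):=\int_0^\infty\nu(\{g>t\})\,dt\in[0,\infty]$ for a nonadditive measure $\nu$ and measurable $g\colon X\to[0,\infty)$. With $\mu^{q/p}(A):=\mu(A)^{q/p}$, define for $f\in\mathcal{F}_0(X)$ $$\|f\|_{p,q}:=\left(\frac{p}{q}\right)^{1/q}\mathrm{Ch}(\mu^{q/p},|f|^q)^{1/q}\in[0,\infty],$$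 and $\mathcal{L}^{p,q}(\mu):=\{f\in\mathcal{F}_0(X):\|f\|_{p,q}<\infty\}$ (in general not a linear space; $\|\cdot\|_{p,q}$ is nevertheless defined on all of $\mathcal{F}_0(X)$). For $\mu$ null-additive, $f\sim g$ iff $\mu(\{|f-g|>c\})=0$ for every $c>0$ is an equivalence relation on $\mathcal{F}_0(X)$; $[f]$ is the class of $f$, with $[f]+[g]:=[f+g]$, $c[f]:=[cf]$; $L^{p,q}(\mu):=\{[f]: f\in\mathcal{L}^{p,q}(\mu)\}$, $\|[f]\|_{p,q}:=\|f\|_{p,q}$ (well-defined when $\mu$ is null-additive), and $S(X):=\{[h]:h\in\mathcal{S}(X)\}$. A subset $D$ of such a space $V$ is dense if for any $x\in V$ and $\varepsilon>0$ there is $y\in D$ with $\|x-y\|_{p,q}<\varepsilon$. *)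

(* Defs.v *)
From HB Require Import structures.
From mathcomp Require Import all_boot all_order all_algebra.
From mathcomp Require Import generic_quotient.
From mathcomp Require Import all_classical all_reals all_analysis.
From mathcomp Require Import measurable_realfun.

Set Implicit Arguments.
Unset Strict Implicit.
Unset Printing Implicit Defensive.

Import Order.TTheory GRing.Theory Num.Theory.
Import numFieldNormedType.Exports.

Local Open Scope classical_set_scope.
Local Open Scope ring_scope.
Local Open Scope ereal_scope.

(* Only the values on measurable sets are meaningful. Nonnegativity follows
   from the two axioms, see [namu_ge0] *)
Record nonadditive_measure d (X : measurableType d) (R : realType) := {
  namu :> set X -> \bar R ;
  namu0 : namu set0 = 0 ;
  le_namu : forall A B : set X, measurable A -> measurable B ->
    A `<=` B -> namu A <= namu B }.

Section nonadditive.
Context d (X : measurableType d) (R : realType).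
Variable mu : nonadditive_measure X R.

Lemma namu_ge0 A : measurable A -> 0 <= mu A.
Proof. by move=> mA; rewrite -(namu0 mu); apply: le_namu. Qed.

Definition conditionally_order_continuous :=
  forall A : (set X)^nat, (forall n, measurable (A n)) ->
    nonincreasing_seq A -> \bigcap_n A n = set0 -> mu (A 0%N) < +oo ->
    mu (A n) @[n --> \oo] --> 0.

Definition null_additive :=
  forall A B : set X, measurable A -> measurable B -> mu B = 0 ->
    mu (A `|` B) = mu A.

End nonadditive.

Definition choquet d (X : measurableType d) (R : realType)
    (nu : set X -> \bar R) (g : X -> R) : \bar R :=
  \int[lebesgue_measure]_(t in `[0%R, +oo[) nu [set x | (t < g x)%R].

Section nonincreasing.
Context (R : realType).
Implicit Types F G : R -> \bar R.

Lemma ereal_rat_dense (a b : \bar R) : a < b ->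
  exists r : rat, a < (ratr r)%:E < b.
Proof.
case: a => [a| |]; case: b => [b| |] //.
- rewrite lte_fin => /rat_in_itvoo[r]; rewrite in_itv/= => /andP[ar rb].
  by exists r; rewrite !lte_fin ar.
- move=> _; have [|r] := @rat_in_itvoo _ a (a + 1)%R; first by rewrite ltrDl.
  by rewrite in_itv/= => /andP[ar _]; exists r; rewrite lte_fin ar ltry.
- move=> _; have [|r] := @rat_in_itvoo _ (b - 1)%R b; first by rewrite gtrBl.
  by rewrite in_itv/= => /andP[_ rb]; exists r; rewrite lte_fin rb ltNyr.
- by exists 0%R; rewrite ltNyr ltry.
Qed.

Lemma countable_jumps F G : (forall s t, (s < t)%R -> G t <= F s) ->
  countable [set t | F t < G t].
Proof.
move=> GF.
apply: (@sub_countable _ _ _ (\bigcup_(r in [set: rat])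
    [set t | F t < (ratr r)%:E < G t])).
  by apply: subset_card_le => t /= /ereal_rat_dense[r FrG]; exists r.
apply: bigcup_countable => // r _.
have [->|/set0P[t /= /andP[Ft Gt]]] :=
  eqVneq [set t | F t < (ratr r)%:E < G t] set0; first exact: countable0.
apply: (@sub_countable _ _ _ [set t]); last exact: countable1.
apply: subset_card_le => s /= /andP[Fs Gs].
have [st|ts|//] := ltgtP s t.
- by have := lt_trans (lt_le_trans Gt (GF _ _ st)) Fs; rewrite ltxx.
- by have := lt_trans (lt_le_trans Gs (GF _ _ ts)) Ft; rewrite ltxx.
Qed.

Lemma nonincreasing_emeasurable F (D : set R) : measurable D ->
  (forall s t, (s < t)%R -> F t <= F s) -> measurable_fun D F.
Proof.
move=> mD Fni; apply: (measurability _ (ErealGenCInfty.measurableE R)).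
move=> _ [_ [r ->] <-]; apply: measurableI => //.
apply: is_interval_measurable => s t /=.
rewrite !in_itv/= !andbT => rs rt u /andP[_].
rewrite in_itv/= andbT [(u <= t)%R]le_eqVlt => /predU1P[->//|ut].
by rewrite (le_trans rt)// Fni.
Qed.

Lemma integral_nonincreasing_eq F G (D : set R) : measurable D ->
  (forall s t, (s < t)%R -> F t <= F s) ->
  (forall s t, (s < t)%R -> G t <= G s) ->
  (forall s t, (s < t)%R -> F t <= G s) ->
  (forall s t, (s < t)%R -> G t <= F s) ->
  \int[lebesgue_measure]_(t in D) F t = \int[lebesgue_measure]_(t in D) G t.
Proof.
move=> mD FF GG FG GF; apply: ae_eq_integral => //.
- exact: nonincreasing_emeasurable.
- exact: nonincreasing_emeasurable.
pose N := [set t | F t < G t] `|` [set t | G t < F t].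
have cN : countable N.
  by rewrite /N -bigcup2E; apply: bigcup_countable => // -[|[|?]] _ /=;
    [exact: countable_jumps|exact: countable_jumps|exact: countable0].
exists N; split.
- by apply: countable_measurable.
- exact: countable_lebesgue_measure0.
- move=> t /= FGt; have [h|h|h] := ltgtP (F t) (G t); [by left|by right|].
  by exfalso; apply: FGt.
Qed.

End nonincreasing.

Section lorentz.
Context d (X : measurableType d) (R : realType).
Variables (mu : nonadditive_measure X R) (p q : R).

Definition pqnorm (f : {mfun X >-> R}) : \bar R :=
  ((p / q) `^ q^-1)%:E *
  poweR (choquet (fun A => poweR (mu A) (q / p)) (fun x => `|f x| `^ q)%R) q^-1.

Definition Lpq : set {mfun X >-> R} := [set f | pqnorm f < +oo].

End lorentz.

Definition simple_mfun d (X : measurableType d) (R : realType) :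
  set {mfun X >-> R} := [set h | finite_set (range h)].

Arguments simple_mfun {d X R}.

(* Density of [D] in [E] for [N], inside an ambient group [V] in which the
   differences live: [E] itself need not be closed under subtraction. *)
Definition dense_in (R : realType) (V : zmodType) (N : V -> \bar R)
    (D E : set V) :=
  forall x, E x -> forall e : R, (0 < e)%R -> exists2 y, D y & N (x - y)%R < e%:E.

Section null_equivalence.
Context d (X : measurableType d) (R : realType).
Variable mu : nonadditive_measure X R.
Implicit Types f g h : {mfun X >-> R}.

Definition null_eq f g :=
  forall c : R, (0 < c)%R -> mu [set x | (c < `|f x - g x|)%R] = 0.

Lemma measurable_gt_mfun (u : X -> R) (t : R) : measurable_fun setT u ->
  measurable [set x | (t < u x)%R].
Proof.
move=> mu_; have := mu_ measurableT `]t, +oo[%classic (measurable_itv _).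
rewrite setTI; congr measurable.
by apply/seteqP; split => x /=; rewrite in_itv/= andbT.
Qed.

Lemma measurable_dist_gt f g (c : R) :
  measurable [set x | (c < `|f x - g x|)%R].
Proof.
by apply: measurable_gt_mfun; apply: measurableT_comp => //;
  apply: measurable_funB.
Qed.

Lemma measurable_powR_level (q : R) f (t : R) :
  measurable [set x | (t < `|f x| `^ q)%R].
Proof.
apply: measurable_gt_mfun; apply: (measurableT_comp (measurable_powR _)).
exact: measurableT_comp.
Qed.

Lemma null_eq_refl f : null_eq f f.
Proof.
move=> c c0; rewrite (_ : [set _ | _] = set0) ?namu0//.
apply/seteqP; split => // x /=.
by rewrite subrr normr0 ltNge ltW.
Qed.

Lemma null_eqC f g : null_eq f g -> null_eq g f.
Proof.
move=> fg c c0; rewrite -(fg c c0); congr (mu _).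
by apply/seteqP; split => x /=; rewrite distrC.
Qed.

Hypothesis na : null_additive mu.

Lemma null_setU A B : measurable A -> measurable B ->
  mu A = 0 -> mu B = 0 -> mu (A `|` B) = 0.
Proof. by move=> mA mB A0 B0; rewrite na. Qed.

Lemma null_sub A B : measurable A -> measurable B -> A `<=` B ->
  mu B = 0 -> mu A = 0.
Proof.
move=> mA mB AB B0; apply/eqP; rewrite eq_le namu_ge0// andbT -B0.
exact: le_namu.
Qed.

Lemma null_eq_trans f g h : null_eq f g -> null_eq g h -> null_eq f h.
Proof.
move=> fg gh c c0; have c2 : (0 < c / 2)%R by rewrite divr_gt0.
apply: (@null_sub _ ([set x | (c / 2 < `|f x - g x|)%R] `|`
                     [set x | (c / 2 < `|g x - h x|)%R])).
- exact: measurable_dist_gt.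
- by apply: measurableU; exact: measurable_dist_gt.
- move=> x /= cx; apply/orP; rewrite -[_ || _]negbK negb_or -!leNgt.
  apply/negP => /andP[h1 h2]; move: cx; rewrite ltNge => /negP; apply.
  by rewrite (le_trans (ler_distD (g x) _ _))// [leRHS]splitr lerD.
- apply: null_setU; [exact: measurable_dist_gt..|exact: fg|exact: gh].
Qed.

Lemma null_eqN f g : null_eq f g -> null_eq (- f)%R (- g)%R.
Proof.
move=> fg c c0; rewrite -(fg c c0); congr (mu _).
by apply/seteqP; split => x /=; rewrite -opprD normrN.
Qed.

Lemma null_eqD f1 f2 g1 g2 : null_eq f1 f2 -> null_eq g1 g2 ->
  null_eq (f1 + g1)%R (f2 + g2)%R.
Proof.
move=> ff gg; apply: (@null_eq_trans _ (f2 + g1)%R).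
- move=> c c0; rewrite -(ff c c0); congr (mu _).
  by apply/seteqP; split => x /=; rewrite opprD addrACA subrr addr0.
- move=> c c0; rewrite -(gg c c0); congr (mu _).
  by apply/seteqP; split => x /=; rewrite opprD addrACA subrr add0r.
Qed.

Lemma null_eq_sup_level f g (q s t : R) : (0 < q)%R -> null_eq f g ->
  (s < t)%R ->
  mu [set x | (t < `|f x| `^ q)%R] <= mu [set x | (s < `|g x| `^ q)%R].
Proof.
move=> q0 fg st.
have mlev := @measurable_powR_level q.
have [s0|s0] := ltP s 0%R.
  rewrite (_ : [set x | (s < _)%R] = setT); last first.
    by apply/seteqP; split => // x _ /=; rewrite (lt_le_trans s0)// powR_ge0.
  by apply: le_namu => //; exact: mlev.
have t0 : (0 <= t)%R by rewrite ltW// (le_lt_trans s0).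
pose c := (t `^ q^-1 - s `^ q^-1)%R.
have c0 : (0 < c)%R.
  by rewrite subr_gt0 gt0_ltr_powR ?invr_gt0// nnegrE.
rewrite -(na (mlev g s) (measurable_dist_gt f g c) (fg _ c0)).
apply: le_namu; [exact: mlev| |].
  by apply: measurableU; [exact: mlev|exact: measurable_dist_gt].
move=> x /= tx; apply/orP; rewrite -[_ || _]negbK negb_or -!leNgt.
apply/negP => /andP[h1 h2]; move: tx; rewrite ltNge => /negP; apply.
have powK (u : R) : (0 <= u)%R -> ((u `^ q^-1) `^ q = u)%R.
  by move=> u0; rewrite -powRrM mulVf ?gt_eqF// powRr1.
have powK' (u : R) : (0 <= u)%R -> ((u `^ q) `^ q^-1 = u)%R.
  by move=> u0; rewrite -powRrM mulfV ?gt_eqF// powRr1.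
have gs : (`|g x| <= s `^ q^-1)%R.
  rewrite -[leLHS]powK'//; apply: ge0_ler_powR => //.
  - by rewrite invr_ge0 ltW.
  - by rewrite nnegrE powR_ge0.
rewrite -[leRHS](powK _ t0); apply: ge0_ler_powR.
- exact: ltW.
- by rewrite nnegrE.
- by rewrite nnegrE powR_ge0.
rewrite -[X in `|X|%R](subrK (g x)) (le_trans (ler_normD _ _))//.
by rewrite -[leRHS](subrK (s `^ q^-1)%R) lerD.
Qed.

Lemma null_eq_pqnorm f g (p q : R) : (0 < p)%R -> (0 < q)%R -> null_eq f g ->
  pqnorm mu p q f = pqnorm mu p q g.
Proof.
move=> p0 q0 fg; rewrite /pqnorm; congr (_ * poweR _ _).
have le (f1 g1 : {mfun X >-> R}) : null_eq f1 g1 -> forall s t, (s < t)%R ->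
    poweR (mu [set x | (t < `|f1 x| `^ q)%R]) (q / p) <=
    poweR (mu [set x | (s < `|g1 x| `^ q)%R]) (q / p).
  move=> fg1 s t st.
  apply: gt0_ler_poweR; first by rewrite divr_ge0 ?ltW.
  - by rewrite in_itv/= leey andbT namu_ge0//; exact: measurable_powR_level.
  - by rewrite in_itv/= leey andbT namu_ge0//; exact: measurable_powR_level.
  - exact: null_eq_sup_level.
apply: integral_nonincreasing_eq => //.
- exact: le (null_eq_refl f).
- exact: le (null_eq_refl g).
- exact: le fg.
- exact: le (null_eqC fg).
Qed.

Local Open Scope quotient_scope.

Let null_eqb f g := `[< null_eq f g >].

Let null_eqb_refl : reflexive null_eqb.
Proof. by move=> f; apply/asboolP; exact: null_eq_refl. Qed.

Let null_eqb_sym : symmetric null_eqb.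
Proof. by move=> f g; apply/asboolP/asboolP; exact: null_eqC. Qed.

Let null_eqb_trans : transitive null_eqb.
Proof.
by move=> g f h /asboolP fg /asboolP gh; apply/asboolP; exact: null_eq_trans gh.
Qed.

Definition null_equiv : equiv_rel {mfun X >-> R} :=
  EquivRel null_eqb null_eqb_refl null_eqb_sym null_eqb_trans.

(* The space of all classes of measurable functions; [null_additive mu] is
   what makes [null_eq] transitive. *)
Definition L0 : Type := {eq_quot null_equiv}.
HB.instance Definition _ := Choice.on L0.
HB.instance Definition _ := EqQuotient.on L0.

Lemma L0_eqP f g : \pi_L0 f = \pi_L0 g <-> null_eq f g.
Proof.
split => [/eqP|fg]; first by rewrite eqmodE => /asboolP.
by apply/eqP; rewrite eqmodE; apply/asboolP.
Qed.

Lemma L0_surj (x : L0) : exists f, x = \pi_L0 f.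
Proof. by exists (repr x); rewrite reprK. Qed.

Lemma L0_repr f : null_eq (repr (\pi_L0 f)) f.
Proof. by apply/L0_eqP; rewrite reprK. Qed.

Definition L0_zero : L0 := \pi_L0 0%R.
Definition L0_opp (x : L0) : L0 := \pi_L0 (- repr x)%R.
Definition L0_add (x y : L0) : L0 := \pi_L0 (repr x + repr y)%R.

Lemma L0_oppE f : L0_opp (\pi_L0 f) = \pi_L0 (- f)%R.
Proof. by apply/L0_eqP/null_eqN/L0_repr. Qed.

Lemma L0_addE f g : L0_add (\pi_L0 f) (\pi_L0 g) = \pi_L0 (f + g)%R.
Proof. by apply/L0_eqP/null_eqD; exact: L0_repr. Qed.

Let L0_addA : associative L0_add.
Proof.
move=> x y z; have [f ->] := L0_surj x.
have [[g ->] [h ->]] := conj (L0_surj y) (L0_surj z).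
by rewrite !L0_addE addrA.
Qed.

Let L0_addC : commutative L0_add.
Proof. by move=> x y; rewrite /L0_add addrC. Qed.

Let L0_add0 : left_id L0_zero L0_add.
Proof. by move=> x; have [f ->] := L0_surj x; rewrite L0_addE add0r. Qed.

Let L0_addN : left_inverse L0_zero L0_opp L0_add.
Proof. by move=> x; have [f ->] := L0_surj x; rewrite L0_oppE L0_addE addNr. Qed.

HB.instance Definition _ :=
  GRing.isZmodule.Build L0 L0_addA L0_addC L0_add0 L0_addN.

Lemma L0_piB f g : (\pi_L0 f - \pi_L0 g = \pi_L0 (f - g))%R.
Proof. by rewrite /GRing.opp /GRing.add/= L0_oppE L0_addE. Qed.

Definition L0_simple : set L0 := [set \pi_L0 h | h in simple_mfun].

Variables p q : R.

Definition L0_pqnorm (x : L0) : \bar R := pqnorm mu p q (repr x).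

Lemma L0_pqnormE f : (0 < p)%R -> (0 < q)%R ->
  L0_pqnorm (\pi_L0 f) = pqnorm mu p q f.
Proof. by move=> p0 q0; apply: null_eq_pqnorm => //; exact: L0_repr. Qed.

Definition L0_Lpq : set L0 := [set \pi_L0 f | f in Lpq mu p q].

End null_equivalence.

Arguments L0 {d X R mu} na.
Arguments L0_simple {d X R mu} na.
Arguments L0_pqnorm {d X R mu} na p q x.
Arguments L0_Lpq {d X R mu} na p q.

(* Main.v *)
(* Choose simple functions h_n with |h_n| <= |f| such that |f - h_n| decreases
   to 0 pointwise. For t > 0 the level sets {|f - h_n|^q > t} decrease to the
   empty set and lie in {|f|^q > t}, which has finite measure for almost every t
   because f is in L^{p,q}; conditional order continuity makes their measures
   tend to 0. The decreasing function t |-> mu({|f|^q > t})^(q/p) is integrable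
   and dominates, so the Choquet integrals tend to 0 by dominated convergence. *)

Require Import Defs.
From mathcomp Require Import all_boot all_order all_algebra.
From mathcomp Require Import all_classical all_reals all_analysis.
From mathcomp Require Import measurable_realfun.

Set Implicit Arguments.
Unset Strict Implicit.
Unset Printing Implicit Defensive.

Import Order.TTheory GRing.Theory Num.Theory.
Import numFieldNormedType.Exports.

Local Open Scope classical_set_scope.
Local Open Scope ring_scope.

Lemma ge0_cvge0P (R : realType) (u : (\bar R)^nat) :
  (forall n, 0 <= u n)%E ->
  u @ \oo --> 0%E <-> forall e : R, 0 < e -> \forall n \near \oo, (u n < e%:E)%E.
Proof.
move=> u0; split=> [ucv e e0|H].
  apply: (ucv [set x | x < e%:E]%E); apply: open_nbhs_nbhs; split => /=.
    exact: open_ereal_lt_ereal.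
  by rewrite lte_fin.
apply/fine_cvgP; split.
  (* The instance [e = 1] makes the sequence eventually finite, so the limit can be taken in [R]. *)
  near=> n; rewrite ge0_fin_numE//; apply: lt_trans (ltry 1).
  by near: n; exact: H.
apply/cvgr0Pnorm_lt => e e0; near=> n.
have un : (u n < e%:E)%E by near: n; exact: H.
rewrite /= ger0_norm ?fine_ge0// -lte_fin fineK// ge0_fin_numE//.
exact: lt_trans un (ltry _).
Unshelve. all: by end_near. Qed.

Lemma cvg_poweR0 (R : realType) (u : (\bar R)^nat) (r : R) : 0 < r ->
  (forall n, 0 <= u n)%E -> u @ \oo --> 0%E -> poweR (u n) r @[n --> \oo] --> 0%E.
Proof.
move=> r0 u0 /(ge0_cvge0P u0) H; apply/ge0_cvge0P => [n|e e0].
  exact: poweR_ge0.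
(* The threshold [e^(1/r)] is the one whose [r]-th power is [e]. *)
have := H (e `^ r^-1) (powR_gt0 _ e0); apply: filterS => n une.
have uf : u n \is a fin_num.
  by rewrite ge0_fin_numE//; exact: lt_trans une (ltry _).
move: (u0 n) une; rewrite -(fineK uf) poweR_EFin !lte_fin lee_fin => un0 une.
rewrite -[ltRHS](@powRr1 _ e) ?ltW// -(mulVf (lt0r_neq0 r0)) powRrM.
by rewrite gt0_ltr_powR// nnegrE powR_ge0.
Qed.

Section simple_approximation.
Context d (X : measurableType d) (R : realType).
Import HBNNSimple HBSimple.

(** Take simple [phi n] increasing to [|f|] and multiply by a simple [e] with [|e| = 1] and
    [f = |f| e]. Then [|f - h n| = |f| - phi n], and the claims become properties of [phi]. *)
Lemma simple_approximation (f : {mfun X >-> R}) :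
  exists h : nat -> {sfun X >-> R}, forall x,
    [/\ (forall n, `|h n x| <= `|f x|),
        (forall n, `|f x - h n x| <= `|f x|),
        nonincreasing_seq (fun n => `|f x - h n x|) &
        `|f x - h n x| @[n --> \oo] --> 0].
Proof.
have mf : measurable_fun setT (fun x => `|f x|%:E).
  by apply: measurableT_comp => //; apply: measurableT_comp.
pose phi := nnsfun_approx measurableT mf.
have phi_ge0 n x : 0 <= phi n x by [].
have phi_le n x : phi n x <= `|f x|.
  by rewrite -lee_fin [X in X%:E](_ : _ = approx setT (fun x => `|f x|%:E) n x)
    ?nnsfun_approxE// le_approx.
have mA : measurable [set x | 0 < f x] by exact: measurable_gt_mfun.
(* The sign of [f], except that [e] is -1 where [f] vanishes. *)
pose e : {sfun X >-> R} := indic_sfun _ mA + indic_sfun _ mA - 1.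
pose h n : {sfun X >-> R} := (phi n : {sfun X >-> R}) * e.
have eE x : e x = if 0 < f x then 1 else -1.
  have -> : e x = \1_[set x | 0 < f x] x + \1_[set x | 0 < f x] x - 1 by [].
  rewrite indicE; have [fx|fx] := ltP.
    by rewrite mem_set// addrK.
  by rewrite memNset ?addr0 ?add0r//= ltNge fx.
have hE n x : h n x = phi n x * e x by [].
have ne x : `|e x| = 1 by rewrite eE; case: ifP; rewrite ?normrN normr1.
have fE x : f x = `|f x| * e x.
  rewrite eE; have [fx|fx] := ltP; first by rewrite mulr1 gtr0_norm.
  by rewrite ler0_norm// mulrN1 opprK.
have dE n x : `|f x - h n x| = `|f x| - phi n x.
  by rewrite {1}fE hE -mulrBl normrM ne mulr1 ger0_norm// subr_ge0.
exists h => x; split=> [n|n|m n mn|].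
- by rewrite hE normrM ne mulr1 ger0_norm.
- by rewrite dE gerBl.
- by rewrite /= !dE lerD2l lerN2; exact/lefP/nd_nnsfun_approx.
- under eq_fun do rewrite dE.
  rewrite -(subrr `|f x|); apply: cvgB; first exact: cvg_cst.
  have f0 y : setT y -> (0 <= `|f y|%:E)%E by rewrite lee_fin.
  by have /fine_cvgP[] := cvg_nnsfun_approx measurableT mf f0 (I : setT x).
Qed.

End simple_approximation.

Section lorentz_approximation.
Context d (X : measurableType d) (R : realType).
Variables (mu : nonadditive_measure X R) (p q : R).
Hypotheses (p_gt0 : 0 < p) (q_gt0 : 0 < q).
Implicit Types f g h : {mfun X >-> R}.
Local Open Scope ereal_scope.

Let level f (t : R) := poweR (mu [set x | (t < `|f x| `^ q)%R]) (q / p).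

(** Two uses: [f = g] gives monotonicity in the level, hence measurability; [s = t] gives
    domination. *)
Lemma le_level f g s t : (forall x, `|f x| <= `|g x|)%R -> (s <= t)%R ->
  level f t <= level g s.
Proof.
move=> fg st; apply: gt0_ler_poweR; first by rewrite divr_ge0 ?ltW.
- by rewrite in_itv/= leey andbT namu_ge0//; exact: measurable_powR_level.
- by rewrite in_itv/= leey andbT namu_ge0//; exact: measurable_powR_level.
apply: le_namu; [exact: measurable_powR_level..|].
move=> x /= /(le_lt_trans st)/lt_le_trans; apply.
by rewrite ge0_ler_powR ?nnegrE ?fg// ltW.
Qed.

Lemma measurable_level f (D : set R) : measurable D ->
  measurable_fun D (level f).
Proof.
by move=> mD; apply: nonincreasing_emeasurable => // s t /ltW; exact: le_level.
Qed.

Let ch f := choquet (fun A => poweR (mu A) (q / p)) (fun x => `|f x| `^ q)%R.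

(** The factor [(p/q)^(1/q)] is positive and finite and the outer exponent [1/q] is positive, so
    neither affects finiteness. *)
Lemma Lpq_choquet f : Lpq mu p q f <-> ch f < +oo.
Proof.
have c0 : (0 < (p / q) `^ q^-1)%R by rewrite powR_gt0// divr_gt0.
rewrite /Lpq /= /pqnorm -/(ch f); split => [fy|fy].
  apply: (@lty_poweRy _ _ q^-1); first by rewrite invr_eq0 gt_eqF.
  by rewrite ltey; apply/eqP => chy; move: fy; rewrite chy gt0_muley ?ltxx.
by rewrite lte_mul_pinfty// ?lee_fin ?ltW// poweR_lty.
Qed.

Lemma Lpq_le f g : (forall x, `|f x| <= `|g x|)%R ->
  Lpq mu p q g -> Lpq mu p q f.
Proof.
move=> fg /Lpq_choquet gy; apply/Lpq_choquet; apply: le_lt_trans gy.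
apply: ge0_le_integral => //.
- by move=> t _; exact: poweR_ge0.
- exact: measurable_level.
- exact: measurable_level.
- by move=> t _; exact: le_level.
Qed.

Hypothesis mu_coc : conditionally_order_continuous mu.

Lemma pqnorm_cvg0 f (g : {mfun X >-> R}^nat) : Lpq mu p q f ->
  (forall n x, `|g n x| <= `|f x|)%R ->
  (forall x, nonincreasing_seq (fun n => `|g n x|%R)) ->
  (forall x, `|g n x|%R @[n --> \oo] --> (0 : R)%R) ->
  pqnorm mu p q (g n) @[n --> \oo] --> 0.
Proof.
move=> /Lpq_choquet fy gf gni g0.
have ch0 h : 0 <= ch h by apply: integral_ge0 => t _; exact: poweR_ge0.
suff chg0 : ch (g n) @[n --> \oo] --> 0.
  rewrite -(mule0 ((p / q) `^ q^-1)%:E); apply: cvgeZl => //.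
  apply: cvg_poweR0 chg0 => [|n]; [by rewrite invr_gt0|exact: ch0].
pose D := `[0%R, +oo[%classic : set R.
have mD : measurable D by exact: measurable_itv.
have if_ : lebesgue_measure.-integrable D (level f).
  apply/integrableP; split; first exact: measurable_level.
  by under eq_integral do rewrite gee0_abs ?poweR_ge0//.
(* Dominated convergence runs over the levels [t] under Lebesgue measure, with majorant
   [level f]. *)
have [||_ _] := @dominated_convergence _ _ _ lebesgue_measure _ mD
    (fun n => level (g n)) (cst 0) (level f)
    (fun n => measurable_level (g n) mD) (measurable_cst _) _ if_; last first.
  by rewrite integral0.
- apply: aeW => t n _; rewrite gee0_abs ?poweR_ge0//; exact: le_level.
(* The level [t = 0] is discarded: the sets where [g n] is nonzero may have nonempty
   intersection. *)
have ae_pos : {ae lebesgue_measure, forall t : R, t != 0%R}.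
  exists [set 0%R]; split => //; first exact: lebesgue_measure_set1.
  by move=> t /= /negP; rewrite negbK => /eqP.
(* Integrability of [level f] makes it finite almost everywhere; this supplies the finite first
   measure that conditional order continuity asks for. *)
have ae_fin : {ae lebesgue_measure, forall t, D t -> level f t \is a fin_num}.
  exact: integrable_ae if_.
apply: (@filterS2 _ _ (ae_filter_ringOfSetsType lebesgue_measure) _ _ _ _
  ae_pos ae_fin) => t t_neq0 + Dt => /(_ Dt) ft.
have t0 : (0 < t)%R by move: Dt; rewrite /D/= in_itv/= andbT lt_def t_neq0.
apply: cvg_poweR0; first by rewrite divr_gt0.
  by move=> n; apply: namu_ge0; exact: measurable_powR_level.
apply: mu_coc.
- by move=> n; exact: measurable_powR_level.
- move=> m n mn; apply/subsetPset => x /= /lt_le_trans; apply.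
  by rewrite ge0_ler_powR ?nnegrE ?(ltW q_gt0)//; exact: gni.
- apply/seteqP; split => // x /= gx.
  (* Once [|g N x| < t^(1/q)], the point [x] has left the level set of [g N]. *)
  have /cvgr0Pnorm_lt /(_ _ (powR_gt0 q^-1 t0)) [N _ /(_ N (leqnn N))] := g0 x.
  rewrite normr_id => /(gt0_ltr_powR q_gt0).
  rewrite !nnegrE normr_ge0 powR_ge0 => /(_ isT isT).
  rewrite -powRrM mulVf ?gt_eqF// powRr1 ?ltW// => gNt.
  by have := lt_trans gNt (gx N I); rewrite ltxx.
- have : mu [set x | (t < `|f x| `^ q)%R] < +oo.
    apply: (@lty_poweRy _ _ (q / p)); first by rewrite gt_eqF// divr_gt0.
    by rewrite ltey_eq ft.
  apply: le_lt_trans; apply: le_namu; [exact: measurable_powR_level..|].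
  move=> x /= /lt_le_trans; apply.
  by rewrite ge0_ler_powR ?nnegrE ?gf// ltW.
Qed.

Import HBSimple.

Lemma simple_dense :
  dense_in (pqnorm mu p q) (simple_mfun `&` Lpq mu p q) (Lpq mu p q).
Proof.
move=> f fL e e0; have [h hf] := simple_approximation f.
have hcv : pqnorm mu p q (f - (h n : {mfun X >-> R}))%R @[n --> \oo] --> 0.
  apply: (@pqnorm_cvg0 f (fun n => f - (h n : {mfun X >-> R}))%R) => //.
  - by move=> n x; have [_ + _ _] := hf x; exact.
  - by move=> x; have [_ _ + _] := hf x; exact.
  - by move=> x; have [_ _ _] := hf x; exact.
have pq0 n : 0 <= pqnorm mu p q (f - (h n : {mfun X >-> R}))%R.
  by rewrite mule_ge0 ?poweR_ge0// lee_fin powR_ge0.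
have /(ge0_cvge0P pq0) /(_ _ e0) [N _ /(_ N (leqnn N)) hN] := hcv.
exists (h N : {mfun X >-> R}) => //; split.
  exact: fimfunP.
(* Membership of [h N] comes from [|h N| <= |f|], since [Lpq] need not be closed under
   subtraction. *)
by apply: Lpq_le fL => x; have [+ _ _ _] := hf x; exact.
Qed.

End lorentz_approximation.

Theorem theorem6p10 (d : measure_display) (X : measurableType d) (R : realType)
  (mu : nonadditive_measure X R) (p q : R) (p_gt0 : 0 < p) (q_gt0 : 0 < q)
  (mu_coc : conditionally_order_continuous mu) :
  dense_in (pqnorm mu p q) (simple_mfun `&` Lpq mu p q) (Lpq mu p q) /\
  forall na : null_additive mu,
    dense_in (L0_pqnorm na p q) (L0_simple na `&` L0_Lpq na p q) (L0_Lpq na p q).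
Proof.
have dense := simple_dense p_gt0 q_gt0 mu_coc; split=> // na _ [f fL <-] e e0.
(* Approximate a representative lying in [Lpq]; differences and norms of classes are computed on
   representatives. *)
have [h [hS hL] fh] := dense f fL e e0.
exists (\pi_(L0 na) h)%qT; first by split; exists h.
by rewrite L0_piB L0_pqnormE.
Qed.
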